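(* A diffeological space $(X,D_X)$ is associated with a (not necessarily paracompact or Hausdorff) finite-dimensional smooth manifold if and only if each of its points is smooth.
   Context: Diffeological space: let $Y$ be a non-empty set. A parametrization in $Y$ is a map $U\to Y$, where $U$ is an open subset of some $\mathbb{R}^n$. A diffeology on $Y$ is a set $D_Y$ of parametrizations in $Y$ such that: (i) (covering) every constant parametrization $\mathbb{R}^n\to Y$ is in $D_Y$; (ii) (locality) if $P$ is a parametrization in $Y$ with domain $\mathrm{dom}(P)$ such that every $r\in\mathrm{dom}(P)$ has an open neighbourhood $V$ with $P|_V\in D_Y$, then $P\in D_Y$; (iii) (smooth compatibility) if $p\colon O\to Y$ is in $D_Y$ with $O\subset\mathbb{R}^n$ open, and $q\colon O'\to O$ is smooth in the usual sense with $O'\subset\mathbb{R}^m$ open, then $p\circ q\in D_Y$. The pair $(Y,D_Y)$ is called a diffeological space, and the elements of $D_Y$ are called plots. Smooth maps: a map $f\colon X\to Y$ between diffeological spaces $(X,D_X)$, $(Y,D_Y)$ is smooth if $f\circ p\in D_Y$ for every $p\in D_X$. It is a diffeomorphism if it is bijective and both $f$ and $f^{-1}$ are smooth. Subset diffeology: for $A\subset X$ with inclusion $\iota_A\colon A\to X$, the subset diffeology $D_A$ consists of all parametrizations $p$ in $A$ with $\iota_A\circ p\in D_X$. $D$-topology: the finest topology on $X$ for which all plots are continuous; that is, $U\subset X$ is open if and only if $p^{-1}(U)$ is open in $O$ for every plot $p\colon O\to X$. Diffeological space associated with a manifold: for a finite-dimensional (not necessarily Hausdorff or paracompact) smooth manifold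 $M$, it is $(M,D_M)$, where $D_M$ consists precisely of the parametrizations of $M$ that are smooth in the classical sense. A diffeological space $(X,D_X)$ is associated with a smooth manifold if $X$ carries a smooth manifold structure $M$ with $D_X=D_M$. Different connected components of a manifold are allowed to have different (finite) dimensions. Smooth point: a point $x\in X$ is called smooth if there is a subset $U\subset X$, open in the ($D$-)topology of $X$ and containing $x$, such that $(U,D_U)$, with $D_U$ the subset diffeology, is diffeomorphic to an open subset of $\mathbb{R}^n$ for some $n$ (possibly depending on $x$), where the open subset of $\mathbb{R}^n$ carries the diffeology of all classically smooth parametrizations. *)

(* Defs.v *)
From HB Require Import structures.
From mathcomp Require Import all_boot all_order all_algebra.
From mathcomp Require Import all_classical all_reals all_analysis.
Set Implicit Arguments.
Unset Strict Implicit.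
Unset Printing Implicit Defensive.
Import Order.TTheory GRing.Theory Num.Theory.
Import numFieldNormedType.Exports.
Local Open Scope classical_set_scope.
Local Open Scope ring_scope.

(* Class C^k on an open set [U]: [F] is C^(k+1) if it is Frechet differentiable
   and its derivative is C^k, i.e. x |-> DF(x)v is C^k for every v. Since [U] is
   open, the values of [F] outside [U] are irrelevant. *)
Fixpoint Ck_on (R : realType) (V W : normedModType R) (k : nat)
    (U : set V) (F : V -> W) : Prop :=
  if k is k'.+1 then
    (forall x, U x -> differentiable F x) /\
    (forall v : V, Ck_on k' U (fun x => 'D_v F x))
  else forall x, U x -> {for x, continuous F}.

Definition smooth_on (R : realType) (V W : normedModType R) (U : set V)
    (F : V -> W) : Prop :=
  forall k, Ck_on k U F.

(* For [U] open, the choice of the total function [F] extending [f] does not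
   matter. *)
Definition smooth_fun (R : realType) (n m : nat) (U : set 'rV[R]_n)
    (f : U -> 'rV[R]_m) : Prop :=
  exists2 F : 'rV[R]_n -> 'rV[R]_m,
    smooth_on U F & forall x : U, F (set_val x) = f x.

Definition set_incl (T : Type) (A B : set T) (sAB : A `<=` B) (x : A) : B :=
  exist _ (set_val x) (mem_set (sAB _ (set_valP x))).

Record parametrization (R : realType) (Y : Type) := Parametrization {
  pdim : nat;
  pdom : set 'rV[R]_pdim;
  pdom_open : open pdom;
  pfun :> pdom -> Y }.
Arguments pdom {R Y} p _.
Arguments pdom_open {R Y} p.
Arguments pfun {R Y} p _.

Definition pconst (R : realType) (Y : Type) (n : nat) (y : Y) :
    parametrization R Y :=
  Parametrization (@openT 'rV[R]_n) (fun=> y).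

Definition prestrict (R : realType) (Y : Type) (p : parametrization R Y)
    (V : set 'rV[R]_(pdim p)) (oV : open V) (sV : V `<=` pdom p) :
    parametrization R Y :=
  Parametrization oV (fun r : V => p (set_incl sV r)).

Definition pprecomp (R : realType) (Y : Type) (p : parametrization R Y)
    (m : nat) (U : set 'rV[R]_m) (oU : open U) (q : U -> pdom p) :
    parametrization R Y :=
  Parametrization oU (p \o q).

Definition ppostcomp (R : realType) (X Y : Type) (f : X -> Y)
    (p : parametrization R X) : parametrization R Y :=
  Parametrization (pdom_open p) (f \o p).

Record is_diffeology (R : realType) (Y : Type)
    (D : set (parametrization R Y)) : Prop := IsDiffeology {
  diffeology_covering : forall (n : nat) (y : Y), D (pconst R n y);
  diffeology_locality : forall p : parametrization R Y,
    (forall r : pdom p, exists (V : set 'rV[R]_(pdim p)) (oV : open V)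
       (sV : V `<=` pdom p), V (set_val r) /\ D (prestrict oV sV)) -> D p;
  diffeology_compat : forall p : parametrization R Y, D p ->
    forall (m : nat) (U : set 'rV[R]_m) (oU : open U) (q : U -> pdom p),
    smooth_fun (set_val \o q) -> D (pprecomp oU q) }.

Section diffeological_notions.
Variable R : realType.

Definition smooth_map (X Y : Type) (DX : set (parametrization R X))
    (DY : set (parametrization R Y)) (f : X -> Y) : Prop :=
  forall p, DX p -> DY (ppostcomp f p).

Definition diffeomorphism (X Y : Type) (DX : set (parametrization R X))
    (DY : set (parametrization R Y)) (f : X -> Y) : Prop :=
  exists g : Y -> X,
    [/\ cancel f g, cancel g f, smooth_map DX DY f & smooth_map DY DX g].

Definition diffeomorphic (X Y : Type) (DX : set (parametrization R X))
    (DY : set (parametrization R Y)) : Prop :=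
  exists f : X -> Y, diffeomorphism DX DY f.

Definition subset_diffeology (X : Type) (D : set (parametrization R X))
    (A : set X) : set (parametrization R A) :=
  [set p | D (ppostcomp set_val p)].

(* [pdom p] carries the topology induced by R^n; as [pdom p] is open,
   being open in [pdom p] or in R^n is the same. *)
Definition D_open (X : Type) (D : set (parametrization R X)) (A : set X) :
    Prop :=
  forall p, D p -> open (pfun p @^-1` A).

Definition euclidean_diffeology (n : nat) (V : set 'rV[R]_n) :
    set (parametrization R V) :=
  [set p : parametrization R V | smooth_fun (set_val \o p)].

Definition smooth_point (X : Type) (D : set (parametrization R X)) (x : X) :
    Prop :=
  exists U : set X, [/\ D_open D U, U x &
    exists (n : nat) (V : set 'rV[R]_n),
      open V /\
      diffeomorphic (@subset_diffeology X D U) (@euclidean_diffeology n V)].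

(* [cmap] and [cinv] are only meaningful on [cdom] and [ccod]. *)
Record chart (M : topologicalType) := Chart {
  cdim : nat;
  cdom : set M;
  ccod : set 'rV[R]_cdim;
  cmap : M -> 'rV[R]_cdim;
  cinv : 'rV[R]_cdim -> M;
  cdom_open : open cdom;
  ccod_open : open ccod;
  cmap_fun : set_fun cdom ccod cmap;
  cinv_fun : set_fun ccod cdom cinv;
  cmapK : {in cdom, cancel cmap cinv};
  cinvK : {in ccod, cancel cinv cmap};
  cmap_continuous : {within cdom, continuous cmap};
  cinv_continuous : {within ccod, continuous cinv} }.
Arguments cdom {M} c _.
Arguments ccod {M} c _.
Arguments cmap {M} c _.
Arguments cinv {M} c _.

(* [cmap c2 \o cinv c1] on the image under [cmap c1] of
   [cdom c1 `&` cdom c2]. *)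
Definition compatible (M : topologicalType) (c1 c2 : chart M) : Prop :=
  smooth_on (ccod c1 `&` (cinv c1 @^-1` cdom c2)) (cmap c2 \o cinv c1).

Record is_smooth_atlas (M : topologicalType) (A : set (chart M)) : Prop :=
  IsSmoothAtlas {
  atlas_cover : forall x : M, exists2 c, A c & cdom c x;
  atlas_compatible : forall c1 c2, A c1 -> A c2 -> compatible c1 c2 }.

(* The topology is neither assumed Hausdorff nor second countable or
   paracompact, and charts may have different dimensions. *)
Record smooth_structure (X : Type) := SmoothStructure {
  mtopology : Topological X;
  atlas : set (chart (Topological.Pack mtopology));
  atlas_smooth : is_smooth_atlas atlas }.
Arguments atlas {X} M _ : rename.

(* A parametrization is classically smooth if it is smooth near every point when
   read in some chart whose domain contains the image of a neighbourhood. *)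
Definition manifold_diffeology (X : Type) (M : smooth_structure X) :
    set (parametrization R X) :=
  [set p | forall r : pdom p, exists2 c, atlas M c & cdom c (p r) /\
    exists (V : set 'rV[R]_(pdim p)) (oV : open V) (sV : V `<=` pdom p),
    [/\ V (set_val r),
        forall s : V, cdom c (prestrict oV sV s) &
        smooth_fun (cmap c \o prestrict oV sV)]].

Definition associated_with_manifold (X : Type)
    (D : set (parametrization R X)) : Prop :=
  exists M : smooth_structure X, D = manifold_diffeology M.

End diffeological_notions.

(* Main.v *)
From HB Require Import structures.
Require Import Defs.
From mathcomp Require Import all_boot all_order all_algebra.
From mathcomp Require Import all_classical all_reals all_analysis.
Set Implicit Arguments.
Unset Strict Implicit.
Unset Printing Implicit Defensive.
Import Order.TTheory GRing.Theory Num.Theory.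
Import numFieldNormedType.Exports.
Local Open Scope classical_set_scope.
Local Open Scope ring_scope.

(** The notion that links the two sides is that of a D-chart (Dchart): a chart
    c such that a parametrization p with values in the domain of c is a plot of
    D if and only if p read in c is smooth. It says that c is a diffeomorphism
    between its domain, with the subset diffeology, and an open subset of a
    Euclidean space, but it mentions neither subtypes nor an inverse map.

    If D is the diffeology of a manifold, the charts of the atlas are D-charts
    (atlas_Dchart): near each of its points a plot is smooth in some chart of
    the atlas, the coordinate changes are smooth, and smoothness is local and
    stable under composition. Plots are continuous, so chart domains are open
    for the D-topology (manifold_D_open), and a D-chart whose domain is
    D-open shows that the points of its domain are smooth
    (Dchart_smooth_point).

    Conversely, let all points be smooth and give X the D-topology. Around each
    point the given diffeomorphism is a D-chart (smooth_point_Dchart). It is a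
    homeomorphism, because it and its inverse carry plots to plots and plots
    are continuous (Dchart_of_coordinates). Any two D-charts are compatible:
    the inverse of the first, restricted to the overlap, is a plot with values
    in the domain of the second (Dchart_compatible). Hence all the D-charts
    together form an atlas. Its manifold diffeology is D, since on both sides
    being a plot is a local property that every D-chart detects
    (manifold_diffeology_Dcharts).

    The analytic input is that C^k maps between Euclidean spaces compose
    (Ck_on_comp). *)

Arguments ccod {R M} c _.
Arguments cinv {R M} c _.
Arguments atlas {R X} M _ : rename.

(** * Calculus of C^k maps *)

Section Ck_calculus.
Variable R : realType.
Implicit Types V W : normedModType R.

(** The first-order expansion of F at x is also one of G, so by uniqueness of the
    differential G has the differential of F at x. *)
Lemma near_eq_differentiable V W (F G : V -> W) (x : V) :
  (\near x, F x = G x) -> differentiable F x -> differentiable G x.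
Proof.
move=> FG dF.
have shiftG : G \o shift x = cst (G x) + 'd F x +o_ 0 id.
  apply/eqaddoP => e e0.
  have /eqaddoP/(_ e e0) := diff_locally dF.
  have : \forall h \near (0 : V), F (h + x) = G (h + x).
    by move: FG; rewrite (near_shift 0) subr0.
  apply: filterS2 => h /= FGh.
  by rewrite /shift /= !fctE /= FGh (nbhs_singleton FG : F x = G x).
have cdF : continuous ('d F x) by exact: diff_continuous.
by apply/diff_locallyP; rewrite (diff_unique cdF shiftG).
Qed.

Lemma nbhs_eq_on V W (U : set V) (F G : V -> W) (x : V) :
  open U -> (forall y, U y -> F y = G y) -> U x -> \near x, F x = G x.
Proof.
by move=> oU FG Ux; apply: filterS (open_nbhs_nbhs (conj oU Ux)).
Qed.

Lemma Ck_on_eq V W k (U : set V) (F G : V -> W) :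
  open U -> (forall x, U x -> F x = G x) -> Ck_on k U F -> Ck_on k U G.
Proof.
move=> oU; elim: k F G => [|k IH] F G FG /=.
  move=> cF x Ux; rewrite /prop_for /continuous_at -(FG _ Ux).
  apply: cvg_trans (cF x Ux).
  apply: near_eq_cvg.
  exact: nbhs_eq_on Ux.
move=> [dF CF]; split=> [x Ux|v].
  by apply: near_eq_differentiable (dF _ Ux); exact: nbhs_eq_on Ux.
apply: IH (CF v) => x Ux.
by apply: near_eq_derive; exact: nbhs_eq_on Ux.
Qed.

Lemma Ck_on_sub V W k (U U' : set V) (F : V -> W) :
  U' `<=` U -> Ck_on k U F -> Ck_on k U' F.
Proof.
move=> sU; elim: k F => [|k IH] F /=; first by move=> cF x /sU/cF.
by move=> [dF CF]; split=> [x /sU/dF|v] //; exact: IH.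
Qed.

Lemma Ck_on_local V W k (U : set V) (F : V -> W) :
  (forall x, U x -> exists2 N, N x & Ck_on k N F) -> Ck_on k U F.
Proof.
elim: k F => [|k IH] F /= loc.
  by move=> x /loc[N Nx]; exact.
split=> [x /loc[N Nx [dF _]]|v]; first exact: dF.
by apply: IH => x /loc[N Nx [_ CF]]; exists N.
Qed.

Lemma Ck_on_continuous V W k (U : set V) (F : V -> W) :
  Ck_on k U F -> forall x, U x -> {for x, continuous F}.
Proof.
by case: k => [//|k] [dF _] x Ux; exact: differentiable_continuous (dF _ Ux).
Qed.

Lemma Ck_onW V W k (U : set V) (F : V -> W) : Ck_on k.+1 U F -> Ck_on k U F.
Proof.
elim: k F => [|k IH] F; first exact: Ck_on_continuous.
by move=> [dF CF]; split=> // v; apply: IH.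
Qed.

Lemma Ck_on_cst V W k (U : set V) (w : W) : Ck_on k U (cst w).
Proof.
elim: k w => [|k IH] w /=; first by move=> x _; exact: cst_continuous.
split=> [x _|v]; first exact: differentiable_cst.
rewrite (_ : (fun x => _) = cst 0) //.
by apply/funext => x; rewrite derive_cst.
Qed.

Lemma Ck_on_add V W k (U : set V) (F G : V -> W) : open U ->
  Ck_on k U F -> Ck_on k U G -> Ck_on k U (fun x => F x + G x).
Proof.
move=> oU; elim: k F G => [|k IH] F G /=.
  by move=> cF cG x Ux; apply: cvgD; [exact: cF|exact: cG].
move=> [dF CF] [dG CG]; split=> [x Ux|v].
  exact: differentiableD (dF _ Ux) (dG _ Ux).
apply: Ck_on_eq (IH _ _ (CF v) (CG v)) => // x Ux.
by rewrite deriveD//; apply: diff_derivable; [exact: dF|exact: dG].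
Qed.

(** The derivative commutes with a continuous linear map L:
    D_v (L o F) = L o D_v F. *)
Lemma Ck_on_linear V W W' k (U : set V) (L : {linear W -> W'}) (F : V -> W) :
  continuous L -> open U -> Ck_on k U F -> Ck_on k U (L \o F).
Proof.
move=> cL oU; elim: k F => [|k IH] F /=.
  by move=> cF x Ux; apply: continuous_comp; [exact: cF|exact: cL].
move=> [dF CF]; split=> [x Ux|v].
  by apply: differentiable_comp (dF _ Ux) _; exact: linear_differentiable.
apply: Ck_on_eq (IH _ (CF v)) => // x Ux.
have dFx := dF x Ux; have dL := @linear_differentiable _ _ _ L (F x) cL.
rewrite !deriveE//=; last exact: differentiable_comp.
by rewrite diff_comp//= diff_lin// deriveE.
Qed.

(** Makes the Leibniz rule Ck_on_bilinear applicable to the product of a scalar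
    function by a vector function. *)
Lemma scaler_is_bilinear V :
  bilinear_for
    (GRing.Scale.Law.clone _ _ *:%R _) (GRing.Scale.Law.clone _ _ *:%R _)
    ( *:%R : R -> V -> V).
Proof.
split=> [v|r] a x y /=; first by rewrite scalerDl scalerA.
by rewrite scalerDr !scalerA mulrC.
Qed.
HB.instance Definition _ V :=
  bilinear_isBilinear.Build R R V V _ _ ( *:%R : R -> V -> V)
    (@scaler_is_bilinear V).

(** Leibniz rule: D_v (b(F, G)) = b(F, D_v G) + b(D_v F, G), whose two terms are
    C^k when F and G are C^(k+1). *)
Lemma Ck_on_bilinear V W1 W2 W' k (U : set V) (b : {bilinear W1 -> W2 -> W'})
    (F : V -> W1) (G : V -> W2) :
  continuous (fun p => b p.1 p.2) -> open U ->
  Ck_on k U F -> Ck_on k U G -> Ck_on k U (fun x => b (F x) (G x)).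
Proof.
move=> cb oU; elim: k F G => [|k IH] F G.
  move=> cF cG x Ux.
  apply: (@continuous_comp _ _ _ (fun x => (F x, G x)) (fun p => b p.1 p.2)).
    by apply: cvg_pair; [exact: cF|exact: cG].
  exact: cb.
move=> CkF CkG; move: (CkF) (CkG) => [dF CF] [dG CG].
have dFG x : U x -> differentiable (fun x => (F x, G x)) x.
  by move=> Ux; apply: differentiable_pair; [exact: dF|exact: dG].
have db p := @differentiable_bilin _ _ _ _ b p cb.
split=> [x Ux|v].
  exact: (differentiable_comp (dFG _ Ux) (db _)).
have := Ck_on_add oU (IH _ _ (Ck_onW CkF) (CG v)) (IH _ _ (CF v) (Ck_onW CkG)).
apply: Ck_on_eq => // x Ux.
have dFx := dF _ Ux; have dGx := dG _ Ux.
rewrite [RHS]deriveE; last exact: (differentiable_comp (dFG _ Ux) (db _)).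
rewrite -[fun x => b (F x) (G x)]
  /((fun p => b p.1 p.2) \o (fun x => (F x, G x))).
rewrite diff_comp//=; last exact: dFG.
by rewrite diff_bilin// diff_pair//= !deriveE.
Qed.

Lemma coord_is_linear n (j : 'I_n) :
  linear (fun N : 'rV[R]_n => N 0 j : R).
Proof. by move=> a u v; rewrite !mxE. Qed.
Definition coord_linear n (j : 'I_n) : {linear 'rV[R]_n -> R} :=
  HB.pack (fun N : 'rV[R]_n => N 0 j : R)
    (GRing.isLinear.Build _ _ _ _ _ (coord_is_linear j)).

(** Induction on k with the chain rule in coordinates,
    D_v (G o F) = sum_j (D_v F)_j (D_(e_j) G o F). Expanding D_v F in the
    canonical basis is what makes the induction work: the direction in which G
    is differentiated must not depend on the point. This is why the middle
    space is a space of row vectors. *)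
Lemma Ck_on_comp n V W k (U : set V) (U' : set 'rV[R]_n)
    (F : V -> 'rV[R]_n) (G : 'rV[R]_n -> W) :
  open U -> (forall x, U x -> U' (F x)) ->
  Ck_on k U F -> Ck_on k U' G -> Ck_on k U (G \o F).
Proof.
move=> oU FU; elim: k W G => [|k IH] W G.
  by move=> cF cG x Ux; apply: continuous_comp; [exact: cF|exact: cG (FU _ Ux)].
move=> CkF [dG CG]; have [dF CF] := CkF.
split=> [x Ux|v].
  by apply: differentiable_comp; [exact: dF|exact: dG (FU _ Ux)].
have coordF j : Ck_on k U (fun x => 'D_v F x 0 j).
  have cL : continuous (coord_linear j) := @coord_continuous _ _ _ _ _.
  exact: (Ck_on_linear cL oU (CF v)).
pose chain x := \sum_(j < n) ('D_v F x 0 j) *: ('D_('e_j) G \o F) x.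
apply: (@Ck_on_eq _ _ _ _ chain) => // [x Ux|]; rewrite /chain.
  have dFx := dF _ Ux; have dGx := dG _ (FU _ Ux).
  rewrite [RHS]deriveE; last exact: differentiable_comp.
  rewrite diff_comp//= [in RHS](row_sum_delta ('d F x v)) linear_sum.
  by apply: eq_bigr => j _; rewrite linearZ/= !deriveE.
elim: (index_enum _) => [|j r IHr].
  rewrite (_ : (fun x => _) = cst 0); first exact: Ck_on_cst.
  by apply/funext => x; rewrite big_nil.
under eq_fun do rewrite big_cons.
apply: Ck_on_add => //.
apply: (@Ck_on_bilinear _ _ _ _ _ _ ( *:%R : {bilinear R -> W -> W})) => //.
  exact: scale_continuous.
exact: IH (Ck_onW CkF) (CG _).
Qed.

Lemma smooth_on_id V (U : set V) : smooth_on U (@id V).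
Proof.
case=> [|k] /=; first by move=> x _; exact: cvg_id.
split=> [x _|v]; first exact: ex_diff.
rewrite (_ : (fun x => _) = cst v); first exact: Ck_on_cst.
by apply/funext => x; rewrite derive_id.
Qed.

Lemma smooth_on_eq V W (U : set V) (F G : V -> W) :
  open U -> (forall x, U x -> F x = G x) -> smooth_on U F -> smooth_on U G.
Proof. by move=> oU FG CF k; exact: Ck_on_eq (CF k). Qed.

Lemma smooth_on_continuous V W (U : set V) (F : V -> W) :
  open U -> smooth_on U F -> {within U, continuous F}.
Proof.
move=> oU /(_ 0%N) cF; rewrite continuous_open_subspace// => x.
by rewrite inE => Ux; exact: cF.
Qed.

End Ck_calculus.

(** * Open subsets and their subtypes *)

Lemma open_within_continuousP (S T : topologicalType) (U : set S) (f : S -> T) :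
  open U ->
  {within U, continuous f} <-> forall A, open A -> open (U `&` f @^-1` A).
Proof.
move=> oU; rewrite continuous_open_subspace//; split=> [cf A oA|opf x].
  rewrite openE => x [Ux Ax]; apply: filterI; first exact: open_nbhs_nbhs.
  by apply: cf; rewrite ?inE//; exact: open_nbhs_nbhs.
rewrite inE => Ux B /=; rewrite !nbhsE /= => -[A [oA Ax] AB].
by exists (U `&` f @^-1` A); [split=> //; exact: opf|move=> y [_ /AB]].
Qed.

Lemma open_image_set_val (T : topologicalType) (U : set T) (O : set U) :
  open U -> open O -> open (set_val @` O).
Proof.
move=> oU [W oW <-].
rewrite (_ : _ @` _ = U `&` W); first exact: openI.
apply/seteqP; split=> [_ [x Wx <-]|x [Ux Wx]].
  by split=> //; exact: set_valP.
by exists (exist _ x (mem_set Ux)).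
Qed.

Lemma open_preimage_set_val (T : topologicalType) (U W : set T) :
  open W -> open (set_val @^-1` W : set U).
Proof. by move=> oW; exists W. Qed.

Lemma valL_val (S T : Type) (U : set S) (v : T) (f : U -> T) (x : U) :
  valL_ v f (set_val x) = f x.
Proof. by rewrite -[RHS](congr1 (@^~ x) (valLK v f)). Qed.

(** * Smooth functions on open subsets of Euclidean spaces *)

Section smooth_fun_theory.
Variable R : realType.

Lemma smooth_fun_eq n m (U : set 'rV[R]_n) (f g : U -> 'rV[R]_m) :
  (forall x, f x = g x) -> smooth_fun f -> smooth_fun g.
Proof. by move=> fg; rewrite (funext fg). Qed.

Lemma smooth_fun_restrict n m (U V : set 'rV[R]_n) (sV : V `<=` U)
    (f : U -> 'rV[R]_m) :
  smooth_fun f -> smooth_fun (f \o set_incl sV).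
Proof.
move=> [F CF Ff]; exists F => [k|x]; first exact: Ck_on_sub (CF k).
exact: (Ff (set_incl sV x)).
Qed.

Lemma smooth_fun_val n (U : set 'rV[R]_n) : smooth_fun (@set_val _ U).
Proof. by exists id => //; exact: smooth_on_id. Qed.

Lemma smooth_fun_comp n m l (U : set 'rV[R]_n) (U' : set 'rV[R]_m)
    (f : U -> 'rV[R]_m) (G : 'rV[R]_m -> 'rV[R]_l) :
  open U -> (forall x, U' (f x)) -> smooth_fun f -> smooth_on U' G ->
  smooth_fun (G \o f).
Proof.
move=> oU fU [F CF Ff] CG; exists (G \o F) => [k|x]; last by rewrite /= Ff.
apply: Ck_on_comp (CF k) (CG k) => // x Ux.
by rewrite (Ff (exist _ x (mem_set Ux))).
Qed.

(** Local extensions of f need not agree outside U, but each agrees on an open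
    subset of U with the extension of f by 0, which is therefore smooth near
    every point of U. *)
Lemma smooth_fun_local n m (U : set 'rV[R]_n) (f : U -> 'rV[R]_m) :
  (forall r : U, exists (V : set 'rV[R]_n) (oV : open V) (sV : V `<=` U),
    V (set_val r) /\ smooth_fun (f \o set_incl sV)) -> smooth_fun f.
Proof.
move=> loc; exists (valL_ 0 f) => [k|x]; last exact: valL_val.
apply: Ck_on_local => x Ux.
have [V [oV [sV [Vx [F CF Ff]]]]] := loc (exist _ x (mem_set Ux)).
exists V => //; apply: Ck_on_eq (CF k) => // y Vy.
by rewrite (Ff (exist _ y (mem_set Vy))) /= -(valL_val 0 f).
Qed.

End smooth_fun_theory.

(** * Parametrizations and D-open sets *)

Section parametrizations.
Variables (R : realType) (X : Type).
Implicit Types (p : parametrization R X) (D : set (parametrization R X)).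

Definition pcorestrict p (A : set X) (pA : forall r, A (p r)) :
    parametrization R A :=
  Parametrization (pdom_open p) (fun r => exist _ (p r) (mem_set (pA r)) : A).

Lemma Parametrization_eq p (f : pdom p -> X) :
  (forall r, f r = p r) -> Parametrization (pdom_open p) f = p.
Proof. by move=> /funext -> {f}; case: p. Qed.

Lemma ppostcomp_corestrict p (A : set X) (pA : forall r, A (p r)) :
  ppostcomp set_val (pcorestrict pA) = p.
Proof. exact: Parametrization_eq. Qed.

Lemma diffeology_restrict D : is_diffeology D ->
  forall p, D p -> forall V (oV : open V) (sV : V `<=` pdom p),
  D (prestrict oV sV).
Proof.
move=> dD p Dp V oV sV.
apply: (diffeology_compat dD Dp oV (q := set_incl sV)).
exact: smooth_fun_val.
Qed.

(** D_open is about subsets of the subtype pdom p; to restrict p to the preimage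
    of A, that preimage is needed as an open subset of R^n. *)
Lemma D_open_preimage D (A : set X) p :
  D_open D A -> D p -> open (set_val @` (pfun p @^-1` A)).
Proof.
by move=> oA Dp; apply: open_image_set_val; [exact: pdom_open|exact: oA].
Qed.

Lemma preimage_pdom p (A : set X) : set_val @` (pfun p @^-1` A) `<=` pdom p.
Proof. by move=> _ [r _ <-]; exact: set_valP. Qed.

Lemma prestrict_preimage p (A : set X)
    (oV : open (set_val @` (pfun p @^-1` A))) (r : set_val @` (pfun p @^-1` A)) :
  A (prestrict oV (@preimage_pdom p A) r).
Proof.
have [s As sr] := set_valP r.
rewrite /prestrict /=.
suff -> : set_incl (@preimage_pdom p A) r = s by [].
exact/val_inj.
Qed.

End parametrizations.

(** * Charts that detect plots *)

Definition Dchart (R : realType) (T : topologicalType)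
    (D : set (parametrization R T)) (c : chart R T) : Prop :=
  forall p : parametrization R T,
    (forall r, cdom c (p r)) -> (D p <-> smooth_fun (cmap c \o p)).

Section Dcharts.
Variables (R : realType) (T : topologicalType) (D : set (parametrization R T)).

(** The chart map and its inverse, corestricted to subtypes, are diffeomorphisms:
    composing with the inverse turns a smooth q into a parametrization of cdom c
    which read in c is q itself. *)
Lemma Dchart_smooth_point (c : chart R T) (x : T) :
  Dchart D c -> D_open D (cdom c) -> cdom c x -> smooth_point D x.
Proof.
move=> Dc oc cx; exists (cdom c); split=> //.
exists (cdim c), (ccod c); split; first exact: ccod_open.
pose f (a : cdom c) : ccod c :=
  exist _ (cmap c (set_val a)) (mem_set (cmap_fun (set_valP a))).
pose g (b : ccod c) : cdom c :=
  exist _ (cinv c (set_val b)) (mem_set (cinv_fun (set_valP b))).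
exists f, g; split.
- move=> a; apply/val_inj; apply: cmapK; exact: valP.
- move=> b; apply/val_inj; apply: cinvK; exact: valP.
- move=> p; apply: (Dc (ppostcomp set_val p) _).1 => r.
  exact: (set_valP (p r)).
- move=> q Eq; apply: (Dc (ppostcomp set_val (ppostcomp g q)) _).2 => [r|].
    exact: (set_valP (g (q r))).
  apply: smooth_fun_eq Eq => r /=.
  by rewrite /g /= cinvK//; exact: valP.
Qed.

Hypothesis dD : is_diffeology D.

(** Read in c, this parametrization is the inclusion of V. *)
Lemma Dchart_cinv (c : chart R T) (V : set 'rV[R]_(cdim c)) (oV : open V) :
  Dchart D c -> V `<=` ccod c ->
  D (Parametrization oV (cinv c \o set_val : V -> T)).
Proof.
move=> Dc sV; apply/Dc => [r|]; first exact: cinv_fun (sV _ (set_valP r)).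
apply: smooth_fun_eq (smooth_fun_val V) => r /=.
by rewrite cinvK// inE; exact: sV (set_valP r).
Qed.

(** By Dchart_cinv the inverse of c1 on the overlap is a plot, and c2 turns plots
    into smooth functions. *)
Lemma Dchart_compatible (c1 c2 : chart R T) :
  Dchart D c1 -> Dchart D c2 -> compatible c1 c2.
Proof.
move=> Dc1 Dc2; rewrite /compatible; set V := _ `&` _.
have oV : open V.
  have /(open_within_continuousP _ (@ccod_open _ _ c1)) := @cinv_continuous _ _ c1.
  by apply; exact: cdom_open.
have sV : V `<=` ccod c1 by move=> x [].
have /(Dc2 _ _).1 := Dchart_cinv oV Dc1 sV.
case=> [r|F CF Ff]; first by have [] := set_valP r.
apply: (smooth_on_eq oV _ CF) => x Vx.
exact: (Ff (exist _ x (mem_set Vx))).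
Qed.

End Dcharts.

(** * The D-topology *)

(** A copy of X that carries the D-topology; the argument D keeps apart the
    topologies of different diffeologies on X. *)
Definition D_space (R : realType) (X : Type) (D : set (parametrization R X)) :
  Type := X.

Section D_topology.
Variables (R : realType) (X : Type) (D : set (parametrization R X)).

Lemma D_openT : D_open D setT.
Proof. by move=> p _; rewrite preimage_setT; exact: openT. Qed.

Lemma D_openI (A B : set X) : D_open D A -> D_open D B -> D_open D (A `&` B).
Proof.
by move=> oA oB p Dp; rewrite preimage_setI; apply: openI; [exact: oA|exact: oB].
Qed.

Lemma D_open_bigcup (I : Type) (F : I -> set X) :
  (forall i, D_open D (F i)) -> D_open D (\bigcup_i F i).
Proof.
move=> oF p Dp; rewrite preimage_bigcup.
by apply: bigcup_open => i _; exact: oF.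
Qed.

HB.instance Definition _ := gen_eqMixin (D_space D).
HB.instance Definition _ := gen_choiceMixin (D_space D).
HB.instance Definition _ :=
  isOpenTopological.Build (D_space D) D_openT D_openI D_open_bigcup.

Lemma open_D_spaceE (A : set (D_space D)) : open A = D_open D A.
Proof. by []. Qed.

End D_topology.

(** * From smooth points to a manifold *)

Section smooth_points.
Variables (R : realType) (X : Type) (D : set (parametrization R X)).
Hypothesis dD : is_diffeology D.

(** The two continuity conditions of a chart come for free. For f, restrict a
    plot to the preimage of U: there f o p is smooth, hence continuous. For g,
    the restriction of g to V is a plot since f o g is the identity of V, and
    plots are continuous for the D-topology. *)
Lemma Dchart_of_coordinates n (U : set (D_space D)) (V : set 'rV[R]_n)
    (f : D_space D -> 'rV[R]_n) (g : 'rV[R]_n -> D_space D) :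
  D_open D U -> open V -> set_fun U V f -> set_fun V U g ->
  {in U, cancel f g} -> {in V, cancel g f} ->
  (forall p : parametrization R X,
    (forall r, U (p r)) -> (D p <-> smooth_fun (f \o p))) ->
  exists2 c : chart R (D_space D), cdom c = U & Dchart (T := D_space D) D c.
Proof.
move=> oU oV fUV gVU fK gK DU.
have cf : {within U, continuous f}.
  apply/(open_within_continuousP f oU) => A oA; rewrite open_D_spaceE => p Dp.
  have oW := D_open_preimage oU Dp.
  set W := set_val @` _ in oW.
  pose q := prestrict oW (@preimage_pdom _ _ p U).
  have qU r : U (q r) by exact: prestrict_preimage.
  have /(DU _ qU)[F CF Fq] : D q by exact: diffeology_restrict.
  have oFA := (open_within_continuousP F oW).1 (smooth_on_continuous oW CF) A oA.
  rewrite (_ : _ @^-1` _ = set_val @^-1` (W `&` F @^-1` A)).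
    exact: open_preimage_set_val.
  have Fp r : W (set_val r) -> F (set_val r) = f (p r).
    move=> Wr; rewrite (Fq (exist _ (set_val r) (mem_set Wr))) /=.
    by congr (f (p _)); exact/val_inj.
  apply/seteqP; split=> r /= [].
    by move=> Upr Afr; have Wr : W (set_val r) by [exists r]; rewrite Fp.
  move=> Wr; rewrite Fp//; split=> //.
  by case: Wr => s Us /val_inj <-.
have cg : {within V, continuous g}.
  apply/(open_within_continuousP g oV) => A oA.
  have Dg : D (Parametrization oV (g \o set_val : V -> X)).
    apply/DU => [r|]; first exact: gVU (set_valP r).
    apply: smooth_fun_eq (smooth_fun_val V) => r /=.
    by rewrite gK//; exact: valP.
  have := D_open_preimage oA Dg; congr open.
  apply/seteqP; split=> [_ [r Ar <-]|x [Vx Ax]].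
    by split=> //; exact: set_valP.
  by exists (exist _ x (mem_set Vx)).
have oU' : open U by rewrite open_D_spaceE.
by exists (Chart oU' oV fUV gVU fK gK cf cg).
Qed.

(** The diffeomorphism f : U -> V and its inverse g, extended to total maps, are
    coordinates. Plots with values in U are plots of the subset diffeology,
    which f and g exchange with the smooth parametrizations in V. *)
Lemma smooth_point_Dchart (x : D_space D) : smooth_point D x ->
  exists2 c : chart R (D_space D), Dchart (T := D_space D) D c & cdom c x.
Proof.
move=> [U [oU Ux [n [V [oV [f [g [fK gK sf sg]]]]]]]].
pose f' : D_space D -> 'rV[R]_n := valL_ 0 (set_val \o f).
pose g' : 'rV[R]_n -> D_space D := valL_ x (set_val \o g).
have f'E a : f' (set_val a) = set_val (f a) by exact: valL_val.
have g'E b : g' (set_val b) = set_val (g b) by exact: valL_val.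
have UE y : U y -> exists a : U, set_val a = y.
  by move=> Uy; exists (exist _ y (mem_set Uy)).
have VE y : V y -> exists a : V, set_val a = y.
  by move=> Vy; exists (exist _ y (mem_set Vy)).
have f'UV : set_fun U V f'.
  by move=> _ /UE[a <-]; rewrite f'E; exact: set_valP.
have g'VU : set_fun V U g'.
  by move=> _ /VE[a <-]; rewrite g'E; exact: set_valP.
have f'K y : U y -> g' (f' y) = y.
  by move=> /UE[a <-]; rewrite f'E g'E fK.
have [||p pU|c cU Dc] := Dchart_of_coordinates oU oV f'UV g'VU.
- by move=> y /set_mem; exact: f'K.
- by move=> _ /set_mem/VE[a <-]; rewrite g'E f'E gK.
- split=> [Dp|sp].
    have /sf : subset_diffeology D (pcorestrict pU).
      by rewrite /subset_diffeology /= ppostcomp_corestrict.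
    by apply: smooth_fun_eq => r /=; rewrite -f'E.
  have pV r : V (f' (p r)) by exact: f'UV.
  pose q : parametrization R V :=
    Parametrization (pdom_open p) (fun r => exist _ (f' (p r)) (mem_set (pV r))).
  have /sg : euclidean_diffeology q by [].
  rewrite /subset_diffeology /=; congr D; apply: Parametrization_eq => r /=.
  by rewrite -g'E; exact: f'K (pU r).
by exists c => //; rewrite cU.
Qed.

(** A plot of D restricted to the D-open preimage of a chart domain is smooth in
    that chart. Conversely a parametrization smooth in charts is locally a plot
    of D, hence a plot by locality. *)
Lemma manifold_diffeology_Dcharts (M : smooth_structure R X) :
  (forall c, atlas M c ->
    @Dchart R (Topological.Pack (mtopology M)) D c) ->
  (forall c, atlas M c -> D_open D (cdom c)) ->
  D = manifold_diffeology M.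
Proof.
move=> DM oM; apply/seteqP; split=> p.
  move=> Dp r; have [c Mc cr] := atlas_cover (atlas_smooth M) (p r).
  exists c => //; split=> //.
  have oW := D_open_preimage (oM _ Mc) Dp.
  pose q := prestrict oW (@preimage_pdom _ _ p (cdom c)).
  have qc (s : pdom q) : cdom c (q s) by exact: prestrict_preimage.
  exists _, oW, (@preimage_pdom _ _ p (cdom c)); split=> //; first by exists r.
  by apply: (DM c Mc q qc).1; exact: diffeology_restrict.
move=> Mp; apply: (diffeology_locality dD) => r.
have [c Mc [cr [V [oV [sV [Vr cV sp]]]]]] := Mp r.
by exists V, oV, sV; split=> //; exact: (DM c Mc (prestrict oV sV) cV).2.
Qed.

Lemma smooth_points_associated :
  (forall x, smooth_point D x) -> associated_with_manifold D.
Proof.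
move=> sD.
have atlasD : is_smooth_atlas (@Dchart R (D_space D) D).
  split=> [x|c1 c2]; first exact: smooth_point_Dchart.
  exact: Dchart_compatible.
exists (@SmoothStructure R X (Topological.class (D_space D)) _ atlasD).
apply: manifold_diffeology_Dcharts => // c _.
exact: (@cdom_open _ _ c).
Qed.

End smooth_points.

(** * From a manifold to smooth points *)

Section manifold.
Variables (R : realType) (X : Type) (M : smooth_structure R X).
Local Notation T := (Topological.Pack (mtopology M)).
Implicit Type p : parametrization R X.

(** Plots are continuous: near r, a plot is the composite of the smooth function
    F, which is the plot read in a chart c, and of the continuous inverse of
    c. *)
Lemma manifold_D_open (A : set T) :
  open A -> D_open (manifold_diffeology M) A.
Proof.
move=> oA p Mp; rewrite openE => r Ar.
have [c Mc [cr [V [oV [sV [Vr cV [F CF Fp]]]]]]] := Mp r.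
have oB := (open_within_continuousP _ (@ccod_open _ _ c)).1
  (@cinv_continuous _ _ c) A oA.
have oVB := (open_within_continuousP F oV).1 (smooth_on_continuous oV CF) _ oB.
have Fp' (s : pdom p) :
    V (set_val s) -> F (set_val s) = cmap c (p s) /\ cdom c (p s).
  move=> Vs; pose s' : V := exist _ (set_val s) (mem_set Vs).
  have s's : set_incl sV s' = s by exact/val_inj.
  by have := cV s'; rewrite (Fp s') /= s's.
rewrite /interior nbhsE /=.
exists (set_val @^-1` (V `&` F @^-1` (ccod c `&` cinv c @^-1` A))).
  split; first exact: open_preimage_set_val.
  have [Fr _] := Fp' r Vr.
  split=> //=; rewrite Fr; split; first exact: cmap_fun.
  by rewrite /= cmapK// inE.
move=> s /= [Vs]; have [-> cs] := Fp' s Vs.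
by rewrite cmapK ?inE// => -[].
Qed.

(** A plot is smooth near each point in some chart c', hence also in c after
    composition with the smooth coordinate change from c' to c. *)
Lemma atlas_Dchart (c : chart R T) :
  atlas M c -> Dchart (T := T) (manifold_diffeology M) c.
Proof.
move=> Mc p pc; split=> [Mp|sp r].
  apply: smooth_fun_local => r.
  have [c' Mc' [_ [V [oV [sV [Vr cV sp]]]]]] := Mp r.
  exists V, oV, sV; split=> //.
  have CG := atlas_compatible (atlas_smooth M) Mc' Mc.
  have pV s : (ccod c' `&` cinv c' @^-1` cdom c) (cmap c' (prestrict oV sV s)).
    split; first exact: cmap_fun (cV s).
    rewrite /= cmapK ?inE; first exact: (pc (set_incl sV s)).
    exact: cV.
  apply: smooth_fun_eq (smooth_fun_comp oV pV sp CG) => s /=.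
  by rewrite cmapK ?inE//; exact: cV.
exists c => //; split; first exact: pc.
exists (pdom p), (pdom_open p), (@subset_refl _ _); split=> [|s|].
- exact: set_valP.
- exact: pc.
- exact: (smooth_fun_restrict (@subset_refl _ (pdom p)) sp).
Qed.

Lemma manifold_smooth_point (x : X) : smooth_point (manifold_diffeology M) x.
Proof.
have [c Mc cx] := atlas_cover (atlas_smooth M) x.
apply: (@Dchart_smooth_point R T _ c) => //; first exact: atlas_Dchart.
by apply: manifold_D_open; exact: cdom_open.
Qed.

End manifold.

Theorem theorem3p14 (R : realType) (X : Type) (X_nonempty : inhabited X)
    (D : set (parametrization R X)) (D_diffeology : is_diffeology D) :
  associated_with_manifold D <-> forall x : X, smooth_point D x.
Proof.
split=> [[M ->] x|]; first exact: manifold_smooth_point.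
exact: smooth_points_associated.
Qed.
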